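(* For $q>0$ let $L$ be the transfer operator $(Lu)(t)=\frac12\sum_{i=0}^{1}\left|\cos\left(\pi\frac{t+i}{2}\right)\right|^qu\left(\frac{t+i}{2}\right)$ acting on continuous functions on $\mathbb{T}$, and let $h_n=L^n1$ for $n\in\mathbb{N}=\{1,2,\dots\}$ (so $h_n$ depends on $q$). (a) If $0<q\le1$, then $h_n''(t)<0$ for all $n\in\mathbb{N}$ and $t\in(0,1)$. (b) There is a function $N:(1,2)\to\mathbb{N}$ with $\lim_{q\to1^+}N(q)=\infty$ such that, for every $1<q<2$, $h_n''(1/2)<0$ for $n=1,\dots,N(q)$. (c) There is a function $N:(2,\infty)\to\mathbb{N}$ with $\lim_{q\to\infty}N(q)=\infty$ such that, for every $2<q<\infty$, $h_n''(1/2)>0$ for $n=1,\dots,N(q)$.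
   Context: $\mathbb{T}=\mathbb{R}/\mathbb{Z}$ is identified with $[0,1]$ with $0$ and $1$ identified. *)

(* Defs.v *)
From HB Require Import structures.
From mathcomp Require Import all_boot all_order all_algebra.
From mathcomp Require Import all_classical all_reals all_analysis.

Set Implicit Arguments.
Unset Strict Implicit.
Unset Printing Implicit Defensive.

Import Order.TTheory GRing.Theory Num.Theory numFieldNormedType.Exports.

Local Open Scope classical_set_scope.
Local Open Scope ring_scope.

(* Functions on R/Z are represented by functions on R of period 1. *)
Definition torus_continuous (R : realType) (u : R -> R) : Prop :=
  periodic u 1 /\ continuous u.

Definition transfer (R : realType) (q : R) (u : R -> R) : R -> R :=
  fun t => 2^-1 * \sum_(i < 2)
    `|cos (pi * ((t + i%:R) / 2))| `^ q * u ((t + i%:R) / 2).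

Definition h (R : realType) (q : R) (n : nat) : R -> R :=
  iter n (transfer q) (fun=> 1).

(* [f^`(2) t] has a default value where f is not twice differentiable, so
   assertions about it are paired with this predicate. *)
Definition twice_derivable (R : realType) (f : R -> R) (t : R) : Prop :=
  (\forall s \near t, derivable f s 1) /\ derivable f^`()%classic t 1.

Lemma continuous_norm_powR (R : realType) (q : R) :
  0 < q -> continuous (fun x : R => `|x| `^ q).
Proof.
move=> q0 x; have [->|x0] := eqVneq x 0.
  apply/cvgrPdist_lt => e e0; rewrite normr0 powR0 ?gt_eqF//.
  have d0 : 0 < e `^ q^-1 by rewrite powR_gt0.
  near=> y; rewrite sub0r normrN ger0_norm ?powR_ge0//.
  have ye : `|y| < e `^ q^-1 by near: y; exact: (@nbhs0_lt R R).
  have -> : e = (e `^ q^-1) `^ q.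
    by rewrite -powRrM mulVf ?gt_eqF// powRr1// ltW.
  by apply: (gt0_ltr_powR q0) ye; rewrite nnegrE ?normr_ge0 ?(ltW d0).
have Hn : \forall y \near x, expR (q * ln `|y|) = `|y| `^ q.
  near=> y; rewrite /powR normr_eq0 ifF//; apply/negbTE.
  by near: y; exact: (cvgr_neq0 _ cvg_id x0).
apply: cvg_trans; first exact: near_eq_cvg Hn.
rewrite {1}/powR normr_eq0 (negbTE x0).
apply: (@continuous_cvg _ _ _ _ _ _ expR); first exact: continuous_expR.
apply: cvgM; first exact: cvg_cst.
apply: (@continuous_cvg _ _ _ _ _ _ (@ln R)).
  by apply: continuous_ln; rewrite normr_gt0.
exact: norm_continuous.
Unshelve. all: by end_near. Qed.

Lemma transfer_periodic (R : realType) (q : R) (u : R -> R) :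
  periodic u 1 -> periodic (transfer q u) 1.
Proof.
move=> pu t; rewrite /transfer !big_ord_recl !big_ord0 /= !addr0.
have -> : (t + 1 + 1%:R) / 2 = t / 2 + 1.
  by rewrite -addrA -[1 + 1%:R]/(2 : R) mulrDl divff// pnatr_eq0.
by rewrite [pi * (_ + 1)]mulrDr mulr1 cosDpi normrN pu [in LHS]addrC.
Qed.

Lemma transfer_continuous (R : realType) (q : R) (u : R -> R) :
  0 < q -> continuous u -> continuous (transfer q u).
Proof.
move=> q0 cu.
have C i : continuous (fun t : R => (t + i%:R) / 2).
  by move=> t; apply: cvgM; [apply: cvgD; [exact: cvg_id|]|]; exact: cvg_cst.
have H i : continuous (fun t : R =>
    `|cos (pi * ((t + i%:R) / 2))| `^ q * u ((t + i%:R) / 2)).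
  move=> t; apply: cvgM.
    apply: (@continuous_cvg _ _ _ _ _ _ (fun x : R => `|x| `^ q)).
      exact: continuous_norm_powR.
    apply: continuous_cvg; first exact: continuous_cos.
    by apply: cvgM; [exact: cvg_cst|exact: C].
  by apply: continuous_cvg; [exact: cu|exact: C].
move=> t; rewrite /transfer; apply: cvgM; first exact: cvg_cst.
rewrite big_ord_recl big_ord1.
under eq_fun do rewrite big_ord_recl big_ord1.
by apply: cvgD; exact: H.
Qed.

Lemma transfer_torus (R : realType) (q : R) (u : R -> R) :
  0 < q -> torus_continuous u -> torus_continuous (transfer q u).
Proof.
move=> q0 [pu cu]; split; first exact: transfer_periodic.
exact: transfer_continuous.
Qed.

Lemma h_torus (R : realType) (q : R) (n : nat) :
  0 < q -> torus_continuous (h q n).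
Proof.
move=> q0; elim: n => [|n IHn]; last exact: transfer_torus.
by split=> // t; exact: cvg_cst.
Qed.

(* Main.v *)
(** Part (a): on (0,1) the function h_{n+1} is the mean of two products
    w_i(t) h_n((t+i)/2) with w_i(t) a power of the sine, concave for q <= 1.
    Since h_n is concave and symmetric about 1/2, in each product the derivatives
    of the two factors have opposite signs, so (w h)'' = w'' h + 2 w' h' + w h''
    is negative.

    Parts (b) and (c): telescoping the products of cosines with
    sin 2x = 2 sin x cos x gives, for 0 < t < 1,
      h_n(t) = 2^-n \sum_(k < 2^n) G_k(t)^q,
      G_k(t) = sin(pi t) / (2^n sin(pi (t + k) / 2^n)).
    Hence h_n''(1/2) is an explicit continuous function of q, negative at q = 1 by
    (a), which gives (b).  Moreover
      (G_k^q)'' = ((q (ln G_k)')^2 + q (ln G_k)'') G_k^q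
    and (ln G_k)'(1/2) <> 0 for n >= 1, so all terms are positive for q large,
    which gives (c).  For n = 1 the sign is that of q - 2. *)
Require Import Defs.
From HB Require Import structures.
From mathcomp Require Import all_boot all_order all_algebra.
From mathcomp Require Import all_classical all_reals all_analysis.
From mathcomp Require Import ring lra.

Set Implicit Arguments.
Unset Strict Implicit.
Unset Printing Implicit Defensive.

Import Order.TTheory GRing.Theory Num.Theory numFieldNormedType.Exports.

Local Open Scope classical_set_scope.
Local Open Scope ring_scope.

(** * Rules for explicit first and second derivatives on (0,1) *)

Definition is_derive2 {R : realType} (f f1 f2 : R -> R) : Prop :=
  forall t : R, 0 < t < 1 ->
    is_derive t (1 : R) f (f1 t) /\ is_derive t (1 : R) f1 (f2 t).

Section Derive2.
Variable R : realType.
Implicit Types (f g : R -> R) (t q : R).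

Lemma near_unit_itv t : 0 < t < 1 -> \forall s \near t, 0 < s < 1.
Proof.
move=> /andP[t0 t1].
by apply: (@nbhs_interval R _ t 0%:E 1%:E) => [||y]; rewrite !lte_fin// => -> ->.
Qed.

Lemma is_derive2_ext f g f1 f2 : (forall t, 0 < t < 1 -> f t = g t) ->
  is_derive2 f f1 f2 -> is_derive2 g f1 f2.
Proof.
move=> fg Df t t01; have [d1 d2] := Df t t01; split=> //.
apply: near_eq_is_derive d1.
by near=> s; apply: fg; near: s; exact: near_unit_itv.
Unshelve. all: by end_near. Qed.

(** Bridge from the explicit triples [f], [f1], [f2] to the form of the theorem. The derivative of
    [f] agrees with [f1] on all of the open interval, hence near [t], and so can be differentiated
    again. *)
Lemma is_derive2_twice f f1 f2 t : is_derive2 f f1 f2 -> 0 < t < 1 ->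
  twice_derivable f t /\ (f^`(2))%classic t = f2 t.
Proof.
move=> Df t01.
have d1 s : 0 < s < 1 -> derivable f s 1 /\ (f^`())%classic s = f1 s.
  by move=> s01; have [[ds fs] _] := Df s s01; rewrite derive1E.
have e1 : \forall s \near t, f1 s = (f^`())%classic s.
  by near=> s; have /d1[] : 0 < s < 1 by near: s; exact: near_unit_itv.
have [_ d2] := Df t t01.
have [dd1 e2] : is_derive t (1 : R) (f^`())%classic (f2 t).
  exact: near_eq_is_derive e1 d2.
rewrite derive1nS derive1n1 derive1E e2.
split=> //; split=> //.
by near=> s; have /d1[] : 0 < s < 1 by near: s; exact: near_unit_itv.
Unshelve. all: by end_near. Qed.

Lemma is_derive2_cst (c : R) : is_derive2 (fun=> c) (fun=> 0) (fun=> 0).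
Proof. by move=> t _; split; exact: is_derive_cst. Qed.

Lemma is_derive2D f f1 f2 g g1 g2 :
  is_derive2 f f1 f2 -> is_derive2 g g1 g2 ->
  is_derive2 (fun t => f t + g t) (fun t => f1 t + g1 t) (fun t => f2 t + g2 t).
Proof.
move=> Df Dg t t01; have [? ?] := Df t t01; have [? ?] := Dg t t01.
by split; exact: is_deriveD.
Qed.

Lemma is_derive1M f g t (a b : R) :
  is_derive t (1 : R) f a -> is_derive t (1 : R) g b ->
  is_derive t (1 : R) (fun s => f s * g s) (a * g t + f t * b).
Proof.
move=> df dg; rewrite addrC [a * _]mulrC.
exact: is_deriveM.
Qed.

Lemma is_derive2M f f1 f2 g g1 g2 :
  is_derive2 f f1 f2 -> is_derive2 g g1 g2 ->
  is_derive2 (fun t => f t * g t) (fun t => f1 t * g t + f t * g1 t)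
    (fun t => f2 t * g t + 2 * (f1 t * g1 t) + f t * g2 t).
Proof.
move=> Df Dg t t01; have [? ?] := Df t t01; have [? ?] := Dg t t01.
split; first exact: is_derive1M.
have d1 : is_derive t (1 : R) (fun s => f1 s * g s) (f2 t * g t + f1 t * g1 t).
  exact: is_derive1M.
have d2 : is_derive t (1 : R) (fun s => f s * g1 s) (f1 t * g1 t + f t * g2 t).
  exact: is_derive1M.
rewrite [X in is_derive _ _ _ X](_ : _ =
  f2 t * g t + f1 t * g1 t + (f1 t * g1 t + f t * g2 t)); last by ring.
exact: is_deriveD.
Qed.

Lemma is_derive2Z (c : R) f f1 f2 : is_derive2 f f1 f2 ->
  is_derive2 (fun t => c * f t) (fun t => c * f1 t) (fun t => c * f2 t).
Proof.
move=> Df t t01; have [? ?] := Df t t01.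
by split; exact: is_deriveZ.
Qed.

Lemma is_derive2_sum n (f f1 f2 : nat -> R -> R) :
  (forall k, (k < n)%N -> is_derive2 (f k) (f1 k) (f2 k)) ->
  is_derive2 (fun t => \sum_(0 <= k < n) f k t)
    (fun t => \sum_(0 <= k < n) f1 k t) (fun t => \sum_(0 <= k < n) f2 k t).
Proof.
elim: n => [|n IHn] Df.
  have E (g : nat -> R -> R) : (fun t => \sum_(0 <= k < 0) g k t) = fun=> 0.
    by apply/funext => t; rewrite big_geq.
  by rewrite !E; exact: is_derive2_cst.
have E (g : nat -> R -> R) : (fun t => \sum_(0 <= k < n.+1) g k t) =
    fun t => \sum_(0 <= k < n) g k t + g n t.
  by apply/funext => t; rewrite big_nat_recr.
rewrite !E; apply: is_derive2D; last exact: Df.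
by apply: IHn => k /ltnW kn; apply: Df.
Qed.

Lemma is_derive_expRM q f (a t : R) : is_derive t (1 : R) f a ->
  is_derive t (1 : R) (fun s => expR (q * f s)) (q * a * expR (q * f t)).
Proof.
move=> ?.
have d : is_derive t (1 : R) (fun s => q * f s) (q * a) by exact: is_deriveZ.
rewrite mulrC.
exact: (@is_derive1_comp _ expR).
Qed.

Lemma is_derive2_expRM q f f1 f2 : is_derive2 f f1 f2 ->
  is_derive2 (fun t => expR (q * f t)) (fun t => q * f1 t * expR (q * f t))
    (fun t => ((q * f1 t) ^+ 2 + q * f2 t) * expR (q * f t)).
Proof.
move=> Df t t01; have [d1 d2] := Df t t01.
have d := is_derive_expRM q d1.
split=> //.
have d3 : is_derive t (1 : R) (fun s => q * f1 s) (q * f2 t).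
  exact: is_deriveZ.
rewrite [X in is_derive _ _ _ X](_ : _ =
  q * f2 t * expR (q * f t) + q * f1 t * (q * f1 t * expR (q * f t))); last by ring.
exact: is_derive1M.
Qed.

Lemma is_derive_affine f (a b d t : R) : is_derive (a * t + b) (1 : R) f d ->
  is_derive t (1 : R) (fun s => f (a * s + b)) (a * d).
Proof.
move=> df.
have da : is_derive t (1 : R) (fun s => a * s + b) a.
  apply: (@is_derive_eq _ _ _ ((a *: (@id R)) + cst b)).
  by rewrite /GRing.scale/= mulr1 addr0.
rewrite mulrC.
exact: (@is_derive1_comp _ f).
Qed.

Lemma is_derive2_affine f f1 f2 (a b : R) :
  (forall t, 0 < t < 1 -> 0 < a * t + b < 1) -> is_derive2 f f1 f2 ->
  is_derive2 (fun t => f (a * t + b)) (fun t => a * f1 (a * t + b))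
    (fun t => a ^+ 2 * f2 (a * t + b)).
Proof.
move=> ab Df t /ab t01; have [d1 d2] := Df _ t01.
split; first exact: is_derive_affine.
rewrite expr2 -mulrA; apply: is_deriveZ.
exact: is_derive_affine.
Qed.

(** Powers of sines are handled as exponentials of [q * ln (sin _)], so this rule and
    [is_derive2_expRM] give all the derivatives of the weights and of the G_k^q. *)
Lemma is_derive2_ln_sin (a b : R) :
  (forall t, 0 < t < 1 -> 0 < sin (a * t + b)) ->
  is_derive2 (fun t => ln (sin (a * t + b)))
    (fun t => a * (cos (a * t + b) / sin (a * t + b)))
    (fun t => - a ^+ 2 / sin (a * t + b) ^+ 2).
Proof.
move=> s0 t /s0 st.
have ds := is_derive_affine (is_derive_sin (a * t + b)).
have dc := is_derive_affine (is_derive_cos (a * t + b)).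
have sn0 : sin (a * t + b) != 0 by rewrite gt_eqF.
have dV := is_deriveV sn0 ds.
split.
  rewrite [X in is_derive _ _ _ X](_ : _ = (sin (a * t + b))^-1 *
    (a * cos (a * t + b))); last by ring.
  by apply: (@is_derive1_comp _ (@ln R)); exact: is_derive1_ln.
rewrite [X in is_derive _ _ _ X](_ : _ =
    a * (a * - sin (a * t + b) / sin (a * t + b) +
     cos (a * t + b) * (- sin (a * t + b) ^- 2 * (a * cos (a * t + b))))).
  by apply: is_deriveZ; apply: is_derive1M.
(* The 1 is expanded as cos^2 + sin^2, which turns the goal into an identity of rational
   expressions. *)
rewrite -[- a ^+ 2]mulr1 -(cos2Dsin2 (a * t + b)); field.
exact: sn0.
Qed.
End Derive2.

(** * Symmetry of h_n, and its concavity for q <= 1 *)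

Section TransferIterates.
Variable R : realType.
Implicit Types (f : R -> R) (t q : R).

(** Differentiating f(1 - s) = f(s) at 1/2 gives f1(1/2) = - f1(1/2), so f1 vanishes there; by the
    mean value theorem f1 is nonincreasing, which fixes its sign on each half. *)
Lemma symmetric_concave_derive f f1 f2 :
  is_derive2 f f1 f2 -> (forall t, f (1 - t) = f t) ->
  (forall t, 0 < t < 1 -> f2 t <= 0) ->
  (forall t, 0 < t <= 2^-1 -> 0 <= f1 t) /\
  (forall t, 2^-1 <= t < 1 -> f1 t <= 0).
Proof.
move=> Df fsym f2le0.
have f1half : f1 2^-1 = 0.
  have d1 : is_derive (2^-1 : R) (1 : R) f (f1 2^-1) by apply: (Df _ _).1; lra.
  have eh : 2^-1 = -1 * 2^-1 + 1 :> R by field.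
  have d2 : is_derive (2^-1 : R) (1 : R) f (- 1 * f1 2^-1).
    rewrite [X in is_derive _ _ X](_ : _ = fun s => f (-1 * s + 1)).
      by apply: is_derive_affine; rewrite -eh.
    by apply/funext => s; rewrite -[LHS]fsym; congr f; ring.
  have := @derive_val _ _ _ _ _ _ _ d2.
  rewrite (@derive_val _ _ _ _ _ _ _ d1); lra.
have f1mono s t : 0 < s -> s < t -> t < 1 -> f1 t <= f1 s.
  move=> s0 st t1.
  have d x : s <= x <= t -> is_derive x (1 : R) f1 (f2 x).
    by move=> /andP[sx xt]; apply: (Df x _).2; lra.
  have [x||c /[!in_itv]/= /andP[sc ct] E] := @MVT _ f1 f2 _ _ st.
  - by rewrite in_itv/= => /andP[sx xt]; apply: d; rewrite !ltW.
  - apply: derivable_within_continuous => x; rewrite in_itv/= => /d dx.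
    exact: ex_derive.
  rewrite -subr_le0 E; apply: mulr_le0_ge0; [apply: f2le0|]; lra.
split=> t /andP[t0 t1].
  have [->|tn] := eqVneq t 2^-1; first by rewrite f1half.
  by rewrite -f1half f1mono//; [rewrite lt_neqAle tn|lra].
have [->|tn] := eqVneq t 2^-1; first by rewrite f1half.
by rewrite -f1half f1mono// lt_neqAle eq_sym tn.
Qed.

Lemma hS q n t : h q n.+1 t = 2^-1 *
  (`|cos (pi * (t / 2))| `^ q * h q n (t / 2) +
   `|cos (pi * ((t + 1) / 2))| `^ q * h q n ((t + 1) / 2)).
Proof.
by rewrite [LHS]/h /= /transfer -/(h q n) big_ord_recl big_ord1 /= addr0.
Qed.

(** The reflection t -> 1 - t exchanges the two inverse branches: 1 - (1 - t)/2 = (t + 1)/2, and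
    |cos(pi x)| is invariant under x -> 1 - x. *)
Lemma h_symmetric q n t : h q n (1 - t) = h q n t.
Proof.
elim: n t => [//|n IHn] t; rewrite !hS.
rewrite -(IHn ((1 - t) / 2)) -(IHn ((1 - t + 1) / 2)).
have -> : 1 - (1 - t) / 2 = (t + 1) / 2 by field.
have -> : 1 - (1 - t + 1) / 2 = t / 2 by field.
have -> : pi * ((1 - t) / 2) = - (pi * ((t + 1) / 2)) + pi by field.
have -> : pi * ((1 - t + 1) / 2) = - (pi * (t / 2)) + pi by field.
by rewrite !cosDpi !normrN !cosN addrC.
Qed.

Lemma powR_expR_ln (x q : R) : 0 < x -> x `^ q = expR (q * ln x).
Proof. by move=> x0; rewrite /powR gt_eqF. Qed.

Lemma sin_pi_gt0 (a b t : R) : 0 < a * t + b < 1 -> 0 < sin (pi * a * t + pi * b).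
Proof.
move=> /andP[h0 h1]; apply: sin_gt0_pi; rewrite -mulrA -mulrDr.
by rewrite mulr_gt0 ?pi_gt0//= gtr_pMr ?pi_gt0.
Qed.

(** A shift by pi/2 turns the cosines into sines that are positive on (0,1), so the absolute values
    disappear and the weights become smooth. The terms [+ 0] and [pi * 0] keep the affine shape that
    the derivative rules expect. *)
Lemma hS_sin q n t : 0 < t < 1 -> h q n.+1 t = 2^-1 *
  (expR (q * ln (sin (pi * 2^-1 * t + pi * 2^-1))) * h q n (2^-1 * t + 0) +
   expR (q * ln (sin (pi * 2^-1 * t + pi * 0))) * h q n (2^-1 * t + 2^-1)).
Proof.
move=> t01; rewrite hS.
have -> : pi * (t / 2) = pi * 2^-1 * t + pi * 2^-1 - pi / 2 by field.
have -> : pi * ((t + 1) / 2) = pi * 2^-1 * t + pi * 0 + pi / 2 by field.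
rewrite cosBpihalf cosDpihalf normrN.
have s1 : 0 < sin (pi * 2^-1 * t + pi * 2^-1) by apply: sin_pi_gt0; lra.
have s2 : 0 < sin (pi * 2^-1 * t + pi * 0) by apply: sin_pi_gt0; lra.
rewrite !gtr0_norm// !powR_expR_ln//.
by congr (_ * (_ * h q n _ + _ * h q n _)); field.
Qed.

(** The left side is the second derivative of sin(a t + b)^q at x = a t + b. It equals - q (a / sin
    x)^2 (1 - q cos^2 x) sin^q x, and 1 - q cos^2 x >= sin^2 x > 0 because q <= 1. *)
Lemma expR_ln_sin_concave (q a x : R) : 0 < q <= 1 -> a != 0 -> 0 < sin x ->
  ((q * (a * (cos x / sin x))) ^+ 2 + q * (- a ^+ 2 / sin x ^+ 2)) *
    expR (q * ln (sin x)) < 0.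
Proof.
move=> /andP[q0 q1] a0 s0; rewrite pmulr_llt0 ?expR_gt0//.
rewrite [ltLHS](_ : _ =
    - (q * (a / sin x) ^+ 2 * (1 - q * cos x ^+ 2))); last first.
  by field; rewrite gt_eqF.
have sq : 0 < (a / sin x) ^+ 2.
  by rewrite exprn_even_gt0//= mulf_neq0 ?invr_eq0 ?(gt_eqF s0).
rewrite oppr_lt0; apply: mulr_gt0; first exact: mulr_gt0.
rewrite cos2sin2; have : 0 < sin x ^+ 2 by rewrite exprn_gt0.
have : 0 <= cos x ^+ 2 by rewrite sqr_ge0.
rewrite cos2sin2; nra.
Qed.

(** Strictness is claimed only for n > 0, since h_0 is constant. The induction uses just the weak
    inequality: at each step strictness comes anew from the weights, whose second derivatives are
    negative and are multiplied by h_n > 0. *)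
Lemma h_concave q n : 0 < q <= 1 -> exists h1 h2 : R -> R,
  [/\ is_derive2 (h q n) h1 h2,
      forall t, 0 < t < 1 -> 0 < h q n t
    & forall t, 0 < t < 1 -> h2 t <= 0 /\ ((0 < n)%N -> h2 t < 0)].
Proof.
move=> q01; have /andP[q0 _] := q01.
elim: n => [|n [h1 [h2 [Dh hgt0 h2lt0]]]].
  exists (fun=> 0), (fun=> 0); split=> //; exact: is_derive2_cst.
have h2le0 t : 0 < t < 1 -> h2 t <= 0 by move=> /h2lt0[].
have [h1ge0 h1le0] := symmetric_concave_derive Dh (h_symmetric q n) h2le0.
have s0 t : 0 < t < 1 -> 0 < sin (pi * 2^-1 * t + pi * 2^-1 : R).
  by move=> t01; apply: sin_pi_gt0; lra.
have s1 t : 0 < t < 1 -> 0 < sin (pi * 2^-1 * t + pi * 0 : R).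
  by move=> t01; apply: sin_pi_gt0; lra.
have DW0 := is_derive2_expRM q (is_derive2_ln_sin s0).
have DW1 := is_derive2_expRM q (is_derive2_ln_sin s1).
have l0 t : 0 < t < 1 -> 0 < 2^-1 * t + 0 < 1 by lra.
have l1 t : 0 < t < 1 -> 0 < 2^-1 * t + 2^-1 < 1 by lra.
have D := is_derive2Z 2^-1 (is_derive2D
  (is_derive2M DW0 (is_derive2_affine l0 Dh))
  (is_derive2M DW1 (is_derive2_affine l1 Dh))).
have pi0 : pi * 2^-1 != 0 :> R by rewrite mulf_neq0// gt_eqF// pi_gt0.
do 2 eexists; split.
- by apply: is_derive2_ext D => t t01; rewrite hS_sin.
- move=> t t01; rewrite hS_sin// mulr_gt0// addr_gt0// mulr_gt0 ?expR_gt0 ?hgt0//.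
    exact: l0.
  exact: l1.
move=> t t01 /=.
suff neg : forall x : R, x < 0 -> x <= 0 /\ ((0 < n.+1)%N -> x < 0).
  apply: neg; rewrite pmulr_rlt0//.
  (* The six terms are w'' h, w' h' and w h'' for each of the two branches; only the w'' h terms are
     strictly negative. *)
  have neg6 (x y z x' y' z' : R) : x < 0 -> y <= 0 -> z <= 0 ->
    x' < 0 -> y' <= 0 -> z' <= 0 -> x + 2 * y + z + (x' + 2 * y' + z') < 0 by lra.
  have W0 := expR_ln_sin_concave q01 pi0 (s0 t t01).
  have W1 := expR_ln_sin_concave q01 pi0 (s1 t t01).
  (* The sign of w' is that of a cosine, which up to sign is the sine in the other weight. The first
     weight decreases and meets h_n on (0,1/2), where h_n' >= 0; the second increases and meets h_n
     on (1/2,1), where h_n' <= 0. *)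
  have c0 : cos (pi * 2^-1 * t + pi * 2^-1 : R) <= 0.
    by have := s1 t t01; rewrite mulr0 addr0 cosDpihalf oppr_le0 => /ltW.
  have c1 : 0 <= cos (pi * 2^-1 * t + pi * 0 : R).
    by have := s0 t t01; rewrite mulr0 addr0 sinDpihalf => /ltW.
  have hp0 := h1ge0 (2^-1 * t + 0).
  have hp1 := h1le0 (2^-1 * t + 2^-1).
  have E x : 0 <= (expR (q * ln (sin x)) : R) by rewrite expR_ge0.
  have dc (c s e d : R) : 0 < s -> 0 <= e -> c * d <= 0 ->
      q * (pi * 2^-1 * (c / s)) * e * (2^-1 * d) <= 0.
    move=> sgt0 e0 cd.
    rewrite [leLHS](_ : _ = (q * (pi * 2^-1) * e / s * 2^-1) * (c * d)); last by ring.
    by rewrite mulr_ge0_le0// !mulr_ge0 ?invr_ge0 ?pi_ge0// ltW.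
  have dh (e d : R) : 0 <= e -> d <= 0 -> e * (2^-1 ^+ 2 * d) <= 0.
    by move=> e0 d0; rewrite mulr_ge0_le0// mulr_ge0_le0// exprn_ge0.
  apply: neg6.
  - by rewrite pmulr_llt0 ?hgt0 ?l0.
  - apply: dc => //; first exact: s0.
    by apply: mulr_le0_ge0 => //; apply: hp0; lra.
  - by apply: dh => //; apply: h2le0; apply: l0.
  - by rewrite pmulr_llt0 ?hgt0 ?l1.
  - apply: dc => //; first exact: s1.
    by apply: mulr_ge0_le0 => //; apply: hp1; lra.
  - by apply: dh => //; apply: h2le0; apply: l1.
by move=> x x0; split=> //; apply: ltW.
Qed.

(** * Explicit formula for h_n and its second derivative *)

(* [hphase n k t] is ln (G_k t); the affine arguments are left in the shape of
   [is_derive2_ln_sin] and [sin_pi_gt0]. *)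
Definition hphase (n k : nat) (t : R) : R :=
  ln (sin (pi * 1 * t + pi * 0)) -
  ln (sin (pi * 2^-1 ^+ n * t + pi * (k%:R * 2^-1 ^+ n))) - n%:R * ln 2.

Definition hphase1 (n k : nat) (t : R) : R :=
  pi * 1 * (cos (pi * 1 * t + pi * 0) / sin (pi * 1 * t + pi * 0)) -
  pi * 2^-1 ^+ n * (cos (pi * 2^-1 ^+ n * t + pi * (k%:R * 2^-1 ^+ n)) /
                    sin (pi * 2^-1 ^+ n * t + pi * (k%:R * 2^-1 ^+ n))).

Definition hphase2 (n k : nat) (t : R) : R :=
  - (pi * 1) ^+ 2 / sin (pi * 1 * t + pi * 0) ^+ 2 -
  - (pi * 2^-1 ^+ n) ^+ 2 / sin (pi * 2^-1 ^+ n * t + pi * (k%:R * 2^-1 ^+ n)) ^+ 2.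

(** The term-by-term second derivative of the sum in [h_explicit], as a closed formula whose
    dependence on [q] can be studied at fixed [t]. *)
Definition hsecond (n : nat) (q t : R) : R :=
  2^-1 ^+ n * \sum_(0 <= k < 2 ^ n)
    ((q * hphase1 n k t) ^+ 2 + q * hphase2 n k t) * expR (q * hphase n k t).

Lemma dyadic_point_itv n k t : (k < 2 ^ n)%N -> 0 < t < 1 ->
  0 < 2^-1 ^+ n * t + k%:R * 2^-1 ^+ n < 1.
Proof.
move=> kn t01; have p : 0 < 2^-1 ^+ n :> R by rewrite exprn_gt0.
rewrite [k%:R * _]mulrC -mulrDr mulr_gt0//=; last first.
  by have := ler0n R k; lra.
rewrite exprVn mulrC ltr_pdivrMr ?exprn_gt0// mul1r.
have : k.+1%:R <= 2 ^+ n :> R by rewrite -natrX ler_nat.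
rewrite -natr1; lra.
Qed.

Lemma is_derive2_hphase n k : (k < 2 ^ n)%N ->
  is_derive2 (hphase n k) (hphase1 n k) (hphase2 n k).
Proof.
move=> kn.
have s0 t : 0 < t < 1 -> 0 < sin (pi * 1 * t + pi * 0 : R).
  by move=> t01; apply: sin_pi_gt0; lra.
have s1 t : 0 < t < 1 -> 0 < sin (pi * 2^-1 ^+ n * t + pi * (k%:R * 2^-1 ^+ n) : R).
  by move=> t01; apply: sin_pi_gt0; apply: dyadic_point_itv.
have := is_derive2D (is_derive2D (is_derive2_ln_sin s0)
  (is_derive2Z (-1) (is_derive2_ln_sin s1))) (is_derive2_cst (- (n%:R * ln 2))).
rewrite [X in is_derive2 X](_ : _ = hphase n k); last first.
  by apply/funext => t; rewrite /hphase; ring.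
rewrite [X in is_derive2 _ X](_ : _ = hphase1 n k); last first.
  by apply/funext => t; rewrite /hphase1; ring.
rewrite [X in is_derive2 _ _ X](_ : _ = hphase2 n k)//.
by apply/funext => t; rewrite /hphase2; ring.
Qed.

Lemma sum_nat_even_odd N (f : nat -> R) :
  \sum_(0 <= k < 2 * N) f k = \sum_(0 <= k < N) (f k.*2 + f k.*2.+1).
Proof.
elim: N => [|N IHN]; first by rewrite muln0 !big_geq.
by rewrite mulnS addSn add1n !big_nat_recr//= IHN mul2n addrA.
Qed.

(** By sin(pi t) = 2 sin(pi t/2) sin(pi t/2 + pi/2), each weight times the numerator of G_k at its
    branch point is sin(pi t)/2; the factor 1/2 is the extra [ln 2]. In the denominators, (t/2 +
    k)/2^n = (t + 2k)/2^(n+1), and the other branch gives 2k + 1. *)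
Lemma hphase_step n k t : (k < 2 ^ n)%N -> 0 < t < 1 ->
  ln (sin (pi * 2^-1 * t + pi * 2^-1)) + hphase n k (2^-1 * t + 0) =
    hphase n.+1 k.*2 t /\
  ln (sin (pi * 2^-1 * t + pi * 0)) + hphase n k (2^-1 * t + 2^-1) =
    hphase n.+1 k.*2.+1 t.
Proof.
move=> kn t01.
have s0 : 0 < sin (pi * 2^-1 * t + pi * 2^-1) by apply: sin_pi_gt0; lra.
have s1 : 0 < sin (pi * 2^-1 * t + pi * 0) by apply: sin_pi_gt0; lra.
have E : ln (sin (pi * 1 * t + pi * 0)) = ln 2 +
    ln (sin (pi * 2^-1 * t + pi * 2^-1)) + ln (sin (pi * 2^-1 * t + pi * 0)).
  rewrite -!lnM ?posrE ?mulr_gt0//; congr ln.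
  have -> : pi * 1 * t + pi * 0 = (pi * 2^-1 * t + pi * 0) *+ 2 by field.
  by rewrite sin_mulr2n sinDpihalf mulr0 addr0; ring.
split; rewrite /hphase E -natr1 exprS.
  have -> : pi * 1 * (2^-1 * t + 0) + pi * 0 = pi * 2^-1 * t + pi * 0 by field.
  have -> : pi * (2^-1 * 2^-1 ^+ n) * t + pi * ((k.*2)%:R * (2^-1 * 2^-1 ^+ n)) =
            pi * 2^-1 ^+ n * (2^-1 * t + 0) + pi * (k%:R * 2^-1 ^+ n).
    by rewrite -mul2n natrM; field; rewrite ?expf_neq0.
  ring.
have -> : pi * 1 * (2^-1 * t + 2^-1) + pi * 0 = pi * 2^-1 * t + pi * 2^-1 by field.
have -> : pi * (2^-1 * 2^-1 ^+ n) * t + pi * ((k.*2.+1)%:R * (2^-1 * 2^-1 ^+ n)) =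
          pi * 2^-1 ^+ n * (2^-1 * t + 2^-1) + pi * (k%:R * 2^-1 ^+ n).
  by rewrite -[k.*2.+1%:R]natr1 -mul2n natrM; field; rewrite ?expf_neq0.
ring.
Qed.

Lemma h_explicit q n t : 0 < t < 1 ->
  h q n t = 2^-1 ^+ n * \sum_(0 <= k < 2 ^ n) expR (q * hphase n k t).
Proof.
elim: n t => [|n IHn] t t01.
  rewrite expr0 mul1r expn0 big_nat1 /hphase.
  (* For n = 0 the only index is k = 0, and the numerator and denominator of G_0 coincide. *)
  rewrite [X in q * X](_ : _ = 0) ?mulr0 ?expR0//.
  by rewrite expr0 !mulr1 mulr0n !mulr0 subrr mul0r subr0.
rewrite hS_sin// !IHn; [|lra|lra].
rewrite expnS sum_nat_even_odd big_split/= exprS -[RHS]mulrA; congr (_ * _).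
rewrite mulrDr !mulr_sumr.
congr (_ + _); apply: eq_big_nat => k /andP[_ kn];
  have [e0 e1] := hphase_step kn t01;
  rewrite -?e0 -?e1 [q * (ln _ + _)]mulrDr [expR (q * ln _ + _)]expRD; ring.
Qed.

Lemma is_derive2_h q n : exists h1, is_derive2 (h q n) h1 (hsecond n q).
Proof.
have D := is_derive2Z (2^-1 ^+ n) (is_derive2_sum (fun k (kn : (k < 2 ^ n)%N) =>
  is_derive2_expRM q (is_derive2_hphase kn))).
by eexists; apply: is_derive2_ext D => t t01; rewrite h_explicit.
Qed.
End TransferIterates.

(** * The second derivative at 1/2 as a function of q *)

Section MidpointSign.
Variable R : realType.
Implicit Types (t q : R).

Lemma derive2_h q n t : 0 < t < 1 ->
  twice_derivable (h q n) t /\ ((h q n)^`(2))%classic t = hsecond n q t.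
Proof. by move=> t01; have [h1 D] := is_derive2_h q n; exact: is_derive2_twice D t01. Qed.

Lemma h_concave_derive2 q n t : 0 < q <= 1 -> (0 < n)%N -> 0 < t < 1 ->
  twice_derivable (h q n) t /\ ((h q n)^`(2))%classic t < 0.
Proof.
move=> q01 n0 t01; have [h1 [h2 [D _ h2lt0]]] := h_concave n q01.
have [td ->] := is_derive2_twice D t01.
by split=> //; exact: (h2lt0 t t01).2.
Qed.

Lemma half01 : 0 < (2^-1 : R) < 1. Proof. by lra. Qed.

Lemma continuous_nat_sum N (f : nat -> R -> R) :
  (forall k, continuous (f k)) -> continuous (fun q => \sum_(0 <= k < N) f k q).
Proof.
move=> cf; elim: N => [|N IHN] q.
  have -> : (fun x => \sum_(0 <= k < 0) f k x) = fun=> 0.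
    by apply/funext => x; rewrite big_geq.
  exact: cvg_cst.
have -> : (fun x => \sum_(0 <= k < N.+1) f k x) =
    fun x => \sum_(0 <= k < N) f k x + f N x.
  by apply/funext => x; rewrite big_nat_recr.
by apply: cvgD; [exact: IHN|exact: cf].
Qed.

Lemma continuous_hsecond n t : continuous (fun q => hsecond n q t).
Proof.
move=> q; apply: cvgM; first exact: cvg_cst.
apply: continuous_nat_sum => k {}q.
have cq (c : R) : (fun x : R => x * c) @ q --> q * c.
  by apply: cvgM; [exact: cvg_id|exact: cvg_cst].
apply: cvgM.
  apply: cvgD; last exact: cq.
  by apply: (cvgM (cq _) (cq _)).
by apply: continuous_cvg; [exact: continuous_expR|exact: cq].
Qed.

Lemma hsecond_lt0_near1 n : (0 < n)%N ->
  \forall q \near (1 : R)^'+, hsecond n q 2^-1 < 0.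
Proof.
move=> n0.
have [_] := @h_concave_derive2 1 n 2^-1 ltac:(lra) n0 half01.
(* Part (a) bounds the actual second derivative; it is identified here with the explicit formula at
   q = 1, which is continuous in q. *)
rewrite (derive2_h 1 n half01).2 => h0.
apply: cvgr_lt h0.
by apply: cvg_at_right_filter; exact: continuous_hsecond.
Qed.

Lemma hphase1_half n k :
  hphase1 n k (2^-1 : R) = - (pi * 2^-1 ^+ n *
    (cos (pi * ((2^-1 + k%:R) * 2^-1 ^+ n)) / sin (pi * ((2^-1 + k%:R) * 2^-1 ^+ n)))).
Proof.
rewrite /hphase1 mulr1 mulr0 addr0 cos_pihalf mul0r mulr0 sub0r.
by have -> : pi * 2^-1 ^+ n * 2^-1 + pi * (k%:R * 2^-1 ^+ n) =
  pi * ((2^-1 + k%:R) * 2^-1 ^+ n) :> R by ring.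
Qed.

Lemma hphase2_half n k :
  hphase2 n k (2^-1 : R) = (pi * 2^-1 ^+ n) ^+ 2 /
    sin (pi * ((2^-1 + k%:R) * 2^-1 ^+ n)) ^+ 2 - pi ^+ 2.
Proof.
rewrite /hphase2 mulr1 mulr0 addr0 sin_pihalf.
have -> : pi * 2^-1 ^+ n * 2^-1 + pi * (k%:R * 2^-1 ^+ n) =
  pi * ((2^-1 + k%:R) * 2^-1 ^+ n) :> R by ring.
by rewrite expr1n invr1; ring.
Qed.

Lemma sin_midpoint_gt0 n k : (k < 2 ^ n)%N ->
  0 < sin (pi * ((2^-1 + k%:R) * 2^-1 ^+ n)) :> R.
Proof.
move=> kn; have := sin_pi_gt0 (dyadic_point_itv kn half01).
by congr (is_true (0 < sin _)); ring.
Qed.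

(** The angles are pi/4 and 3 pi/4, where sin^2 = cos^2 = 1/2, so both terms have the same
    coefficient. The resulting sign q - 2 secures n = 1 on the whole range of q in (b) and (c). *)
Lemma hsecond1_half q : hsecond 1 q 2^-1 = q * (q - 2) * ((pi / 2) ^+ 2 *
  (2^-1 * \sum_(0 <= k < 2) expR (q * hphase 1 k 2^-1))).
Proof.
have sc k : (k < 2)%N ->
    0 < sin (pi * ((2^-1 + k%:R) * 2^-1 ^+ 1) : R) /\
    cos (pi * ((2^-1 + k%:R) * 2^-1 ^+ 1)) ^+ 2 = 2^-1 :> R.
  move=> k2; split.
    exact: (sin_midpoint_gt0 (n := 1) k2).
  (* The doubled angle is pi/2 + k pi, so the double-angle formula gives cos^2 = 1/2 for both values
     of k at once. *)
  have : cos ((pi * ((2^-1 + k%:R) * 2^-1 ^+ 1)) *+ 2) = 0 :> R.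
    rewrite expr1 [X in cos X](_ : _ = pi / 2 + pi *+ k); last first.
      by rewrite -mulr_natr; field.
    by case: k k2 => [|[|//]] _; rewrite ?addr0 ?cosDpi cos_pihalf ?oppr0.
  rewrite cos_mulr2n; lra.
rewrite /hsecond expr1 expn1; set S := \sum_(0 <= k < 2) expR _.
rewrite [RHS](_ : _ = 2^-1 * (q * (q - 2) * (pi / 2) ^+ 2 * S)); last by ring.
congr (_ * _); rewrite mulr_sumr.
apply: eq_big_nat => k /andP[_ /sc[s0 c2]]; congr (_ * _).
rewrite hphase1_half hphase2_half.
set s := sin _ in s0 *; set c := cos _ in c2 *.
have s2 : s ^+ 2 = 2^-1 by rewrite sin2cos2 c2; field.
have sn0 : s != 0 by rewrite gt_eqF.
transitivity (q ^+ 2 * (pi / 2) ^+ 2 * c ^+ 2 / (s ^+ 2) +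
  q * ((pi / 2) ^+ 2 / (s ^+ 2) - pi ^+ 2)); first by field.
by rewrite s2 c2; field.
Qed.

Lemma hphase1_half_neq0 n k : (0 < n)%N -> (k < 2 ^ n)%N ->
  hphase1 n k (2^-1 : R) != 0.
Proof.
move=> n0 kn; rewrite hphase1_half oppr_eq0.
have s0 := sin_midpoint_gt0 kn.
have x01 := dyadic_point_itv kn half01.
rewrite [2^-1 ^+ n * 2^-1]mulrC -mulrDl in x01.
have /andP[x0 x1] := x01.
rewrite !mulf_neq0 ?invr_eq0 ?(gt_eqF s0) ?expf_neq0 ?(gt_eqF (pi_gt0 R))//.
(* cos x = 0 on [0, pi] forces x = pi / 2, i.e. 2 k + 1 = 2 ^ n. *)
apply/eqP => c0; have cE := etrans c0 (esym (cos_pihalf R)).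
have p0 := pi_gt0 R.
have /(mulfI (lt0r_neq0 p0)) xE : pi * ((2^-1 + k%:R) * 2^-1 ^+ n) = pi * 2^-1 :> R.
  apply: cos_inj cE; rewrite in_itv/=.
    by rewrite mulr_ge0 ?(ltW p0) ?(ltW x0)//= ger_pMr// ltW.
  by rewrite mulr_ge0 ?(ltW p0)//= ger_pMr//; lra.
have : (k.*2.+1)%:R = (2 ^ n)%:R :> R.
  rewrite natrX -[LHS]natr1 -mul2n natrM.
  rewrite (_ : 2 * k%:R + 1 = 2 * (2^-1 + k%:R)); last by field.
  have := congr1 (fun x => 2 * 2 ^+ n * x) xE.
  rewrite /= exprVn => E.
  suff -> : 2 ^+ n = 2 * 2 ^+ n * 2^-1 :> R by rewrite -E; field; rewrite expf_neq0.
  by field.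
(* Parity: 2k + 1 is odd, while 2^n is even because n > 0. *)
move=> /(mulrIn (oner_neq0 R)) /(congr1 odd).
by rewrite /= odd_double oddX; case: (n) n0.
Qed.

Lemma near_forall_lt (F : set_system R) {FF : Filter F} N (P : nat -> R -> Prop) :
  (forall k, (k < N)%N -> \forall q \near F, P k q) ->
  \forall q \near F, forall k, (k < N)%N -> P k q.
Proof.
elim: N => [|N IHN] FP; first by near=> q.
have FN : \forall q \near F, P N q by apply: FP.
have {}IHN : \forall q \near F, forall k, (k < N)%N -> P k q.
  by apply: IHN => k kN; apply: FP; rewrite ltnW.
near=> q => k; rewrite ltnS leq_eqVlt => /orP[/eqP ->|].
  by near: q.
by move: k; near: q.
Unshelve. all: by end_near. Qed.

(** [N q] is the largest n <= K q + 1 such that [P m q] holds for all 1 <= m <= n. For fixed n only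
    finitely many conditions must hold near [F], so no uniformity in n is required for [N] to
    diverge. *)
Lemma divergent_cutoff (F : set_system R) {FF : Filter F} (D : R -> Prop)
    (P : nat -> R -> Prop) (K : R -> nat) :
  (forall q, D q -> P 1%N q) ->
  (forall n, (0 < n)%N -> \forall q \near F, P n q) ->
  (forall n, \forall q \near F, (n <= K q)%N) ->
  exists N : R -> nat, [/\ forall q, D q -> (1 <= N q)%N,
    N q @[q --> F] --> \oo
    & forall q n, (1 <= n <= N q)%N -> P n q].
Proof.
move=> P1 PF KF.
pose good q n := `[< forall m, (1 <= m <= n)%N -> P m q >].
(* The cap [K] keeps [N] finite where [P n q] holds for all [n]. *)
pose N q := (\max_(n < (K q).+2 | good q n) n)%N.
exists N; split.
- move=> q Dq.
  have g1 : good q 1%N.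
    by apply/asboolP => m; rewrite -eqn_leq => /eqP <-; exact: P1.
  (* The bound [(K q).+2] keeps the index 1 in range even when [K q] is 0. *)
  exact: (@leq_bigmax_cond _ _ (fun n : 'I_(K q).+2 => n : nat)
    (Ordinal (isT : (1 < (K q).+2)%N)) g1).
- apply/cvgnyPge => n.
  have Fn : \forall q \near F, forall m, (m < n.+1)%N -> (0 < m)%N -> P m q.
    apply: near_forall_lt => -[_|m _]; first by near=> q.
    by apply: filterS (PF m.+1 isT) => q.
  near=> q.
  have nK : (n < (K q).+2)%N.
    by apply: (@leq_trans (K q).+1) => //; rewrite ltnS; near: q.
  have gn : good q n.
    apply/asboolP => m /andP[m0 mn].
    have : forall m, (m < n.+1)%N -> (0 < m)%N -> P m q by near: q.
    by apply.
  exact: (@leq_bigmax_cond _ _ (fun n : 'I_(K q).+2 => n : nat)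
    (Ordinal nK) gn).
(* The maximum of good indices is good: 0 is vacuously good, and the maximum of two indices is one
   of them. *)
- move=> q n; have : good q (N q).
    apply: (big_ind (fun m => good q m)) => //.
      by apply/asboolP => m /andP[m0]; rewrite leqn0 => /eqP m00; rewrite m00 in m0.
    by move=> x y gx gy; rewrite /maxn; case: ifP.
  by move/asboolP; apply.
Unshelve. all: by end_near. Qed.
End MidpointSign.

(** * Positivity for large q, and the conclusion *)

Lemma exp_sum_gt0 (R : realType) n (f : nat -> R) :
  0 < \sum_(0 <= k < 2 ^ n) expR (f k).
Proof.
rewrite -(prednK (expn_gt0 2 n : 0 < 2 ^ n)%N) big_nat_recl//.
by rewrite ltr_pwDl ?expR_gt0// sumr_ge0// => k _; rewrite expR_ge0.
Qed.

(** Each coefficient is q (q a_k^2 + b_k) with a_k nonzero, hence positive once q > 0 and q > - b_k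
    / a_k^2; finitely many k allow a common threshold. *)
Lemma hsecond_gt0_pinfty (R : realType) n : (0 < n)%N ->
  \forall q \near +oo, 0 < hsecond n q (2^-1 : R).
Proof.
move=> n0.
pose a k := hphase1 n k (2^-1 : R).
pose b k := hphase2 n k (2^-1 : R).
have Q : \forall q \near +oo, forall k, (k < 2 ^ n)%N -> 0 < (q * a k) ^+ 2 + q * b k.
  apply: near_forall_lt => k kn.
  have a2 : 0 < a k ^+ 2 by rewrite exprn_even_gt0//= hphase1_half_neq0.
  near=> q.
  have q0 : 0 < q by near: q; exact: nbhs_pinfty_gt.
  have : - b k / a k ^+ 2 < q by near: q; apply: nbhs_pinfty_gt; rewrite num_real.
  rewrite ltr_pdivrMr// => ltb.
  rewrite [ltRHS](_ : _ = q * (q * a k ^+ 2 + b k)); last by ring.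
  by rewrite mulr_gt0//; lra.
near=> q.
have Qq : forall k, (k < 2 ^ n)%N -> 0 < (q * a k) ^+ 2 + q * b k by near: q.
rewrite /hsecond mulr_gt0 ?exprn_gt0// big_mkord.
rewrite (bigD1 (Ordinal (expn_gt0 2 n : (0 < 2 ^ n)%N)))//=.
rewrite ltr_pwDl ?mulr_gt0 ?expR_gt0//; first by apply: Qq; rewrite expn_gt0.
by apply: sumr_ge0 => k _; rewrite mulr_ge0 ?expR_ge0// ltW// Qq.
Unshelve. all: by end_near. Qed.

Theorem proposition4p4 (R : realType) :
  (forall q : R, 0 < q <= 1 ->
     forall n : nat, (1 <= n)%N -> forall t : R, 0 < t < 1 ->
       twice_derivable (h q n) t /\ ((h q n)^`(2))%classic t < 0)
  /\
  (exists N : R -> nat,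
     [/\ forall q : R, 1 < q < 2 -> (1 <= N q)%N,
         N q @[q --> (1 : R)^'+] --> \oo
       & forall q : R, 1 < q < 2 -> forall n : nat, (1 <= n <= N q)%N ->
           twice_derivable (h q n) 2^-1 /\ ((h q n)^`(2))%classic 2^-1 < 0])
  /\
  (exists N : R -> nat,
     [/\ forall q : R, 2 < q -> (1 <= N q)%N,
         N q @[q --> +oo] --> \oo
       & forall q : R, 2 < q -> forall n : nat, (1 <= n <= N q)%N ->
           twice_derivable (h q n) 2^-1 /\ 0 < ((h q n)^`(2))%classic 2^-1]).
Proof.
split; last split.
- move=> q q01 n n1 t t01; exact: h_concave_derive2.
(* The cap is the integer part of 1/(q - 1), which diverges as q tends to 1 from the right. *)
- have [||n|N [N1 Noo NP]] := @divergent_cutoff R (1 : R)^'+ _ (fun q => 1 < q < 2)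
      (fun n q => hsecond n q 2^-1 < 0) (fun q => Num.trunc (q - 1)^-1).
  + move=> q /andP[q1 q2]; rewrite hsecond1_half nmulr_rlt0.
      by rewrite !mulr_gt0 ?invr_gt0 ?pi_gt0 ?(exp_sum_gt0 1).
    by rewrite pmulr_rlt0; lra.
  + exact: hsecond_lt0_near1.
  + near=> q.
    have q1 : 1 < q by near: q; exact: nbhs_right_gt.
    (* This gives 1/(q - 1) >= n + 1 >= n; using n + 1 avoids inverting 0 when n = 0. *)
    have : q < 1 + n.+1%:R^-1.
      by near: q; apply: nbhs_right_lt; rewrite ltrDl invr_gt0.
    rewrite truncn_ge_nat ?invr_ge0 ?subr_ge0 ?(ltW q1)// => qn.
    apply: (@le_trans _ _ n.+1%:R); first by rewrite ler_nat.
    rewrite -[leLHS]invrK lef_pV2 ?posrE ?invr_gt0 ?subr_gt0//.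
    by rewrite lerBlDl ltW.
  exists N; split=> // q q12 n /NP nP.
  by have [td ->] := derive2_h q n (half01 R).
(* At infinity the integer part of q itself serves as the cap. *)
- have [||n|N [N1 Noo NP]] := @divergent_cutoff R (+oo : set_system R) _ (fun q => 2 < q)
      (fun n q => 0 < hsecond n q 2^-1) (fun q => Num.trunc q).
  + move=> q q2; rewrite hsecond1_half mulr_gt0//.
      by rewrite mulr_gt0; lra.
    by rewrite !mulr_gt0 ?invr_gt0 ?pi_gt0 ?(exp_sum_gt0 1).
  + exact: hsecond_gt0_pinfty.
  + near=> q.
    have q0 : 0 <= q by near: q; exact: nbhs_pinfty_ge.
    have nq : n%:R <= q by near: q; apply: nbhs_pinfty_ge; rewrite num_real.
    by rewrite truncn_ge_nat.
  exists N; split=> // q q2 n /NP nP.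
  by have [td ->] := derive2_h q n (half01 R).
Unshelve. all: by end_near. Qed.
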